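(* Let $D$ be an integrally closed local integral domain. If $\mathrm{Zar}_{\min}(D)$ is a Noetherian space, then $D$ is a pseudo-valuation domain.
   Context: Local means having a unique maximal ideal (no Noetherian hypothesis). For an integral domain $D$ with quotient field $K$, $\mathrm{Zar}(D)$ is the set of all valuation domains that contain $D$ and have quotient field $K$ (the valuation overrings of $D$), endowed with the Zariski topology: a subbasis of open sets is given by the sets $\{V\in\mathrm{Zar}(D)\mid x_1,\ldots,x_n\in V\}$, as $x_1,\ldots,x_n$ range in $K$. $\mathrm{Zar}_{\min}(D)$ is the subspace of the elements of $\mathrm{Zar}(D)$ that are minimal with respect to containment. A topological space is Noetherian if its open sets satisfy the ascending chain condition (equivalently, every subset is compact, where compact does not include Hausdorff). An integral domain $D$ with quotient field $K$ is a pseudo-valuation domain if, for every prime ideal $P$ of $D$, whenever $xy\in P$ with $x,y\in K$, then $x\in P$ or $y\in P$; equivalently, $D$ is local and its maximal ideal is also the maximal ideal of some valuation overring of $D$. *)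

(* Defs.v *)
From HB Require Import structures.
From mathcomp Require Import all_boot all_algebra.
From mathcomp Require Import all_classical topology.

Set Implicit Arguments.
Unset Strict Implicit.
Unset Printing Implicit Defensive.

Import GRing.Theory.
Local Open Scope classical_set_scope.
Local Open Scope ring_scope.

(* Throughout, D is an integral domain, its quotient field is {fraction D}, and
   D is embedded in it by tofrac. *)

Definition integrally_closed (D : idomainType) : Prop :=
  forall x : {fraction D}, integralOver (@tofrac D) x -> range (@tofrac D) x.

(* idealr_closed includes properness: 1 is not in the ideal. *)
Definition maximal_ideal (D : idomainType) (M : set D) : Prop :=
  idealr_closed [in M] /\
  forall I : set D, idealr_closed [in I] -> M `<=` I -> I = M.

Definition local_domain (D : idomainType) : Prop :=
  exists! M : set D, maximal_ideal M.

Definition prime_ideal (D : idomainType) (P : set D) : Prop :=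
  idealr_closed [in P] /\ prime_idealr_closed [in P].

Definition pseudo_valuation_domain (D : idomainType) : Prop :=
  forall P : set D, prime_ideal P -> forall x y : {fraction D},
    (@tofrac D @` P) (x * y) -> (@tofrac D @` P) x \/ (@tofrac D @` P) y.

(* A subring V of a field K is a valuation domain with quotient field K when,
   for every nonzero x in K, x or its inverse lies in V. *)
Record Zar (D : idomainType) := MkZar {
  zar_ring :> set {fraction D};
  zar_subring : subring_closed [in zar_ring];
  zar_overring : range (@tofrac D) `<=` zar_ring;
  zar_valuation : forall x, x != 0 -> zar_ring x \/ zar_ring x^-1 }.

Definition zar_subbase (D : idomainType) : set (set (Zar D)) :=
  [set [set V : Zar D | forall x, x \in s -> zar_ring V x]
     | s in [set: seq {fraction D}]].

HB.instance Definition _ (D : idomainType) := gen_eqMixin (Zar D).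
HB.instance Definition _ (D : idomainType) := gen_choiceMixin (Zar D).
HB.instance Definition _ (D : idomainType) :=
  isSubBaseTopological.Build (Zar D) (@zar_subbase D) id.

Definition Zar_min (D : idomainType) : set (Zar D) :=
  [set V : Zar D | forall W : Zar D, W `<=` V -> V `<=` W].

Definition noetherian_space (T : topologicalType) : Prop :=
  forall U : nat -> set T, (forall n, open (U n)) ->
    (forall n, U n `<=` U n.+1) ->
    exists N, forall n, (N <= n)%N -> U n = U N.

(* Main.v *)
Require Import Defs.
From mathcomp Require Import all_boot all_algebra.
From mathcomp Require Import all_classical topology.
From mathcomp Require Import ring.

Set Implicit Arguments.
Unset Strict Implicit.
Unset Printing Implicit Defensive.

Import GRing.Theory.
Local Open Scope classical_set_scope.
Local Open Scope ring_scope.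

(** Let m be the maximal ideal of D and K its quotient field. The core is a
    divisibility property: if t lies in m and y in K does not lie in D, then
    t / y lies in D ([noetherian_div]). Suppose it does not. Write v for the
    valuation of a valuation overring V. Since neither y nor t / y is in D, and
    D is closed under taking roots in K, the elements e_n = t^n / y^(n+1) and
    their inverses all lie outside D. An element w of K such that neither w nor
    1/w is in D is a unit of some minimal valuation overring dominating D
    ([exists_min_unit]), so each equality v(y) = n/(n+1) v(t) occurs in some
    minimal V with v(t) > 0. As v(t) >= 0 in every V, the open sets
    U_n = {V | e_n in V} = {V | v(y) <= n/(n+1) v(t)} therefore form a
    strictly ascending sequence, which a Noetherian space does not have.

    The units w come from the fact that an element x outside the integrally
    closed local domain D is missed by a minimal valuation overring dominating
    D, applied to x = 1/(w - 1): in such a ring w is congruent to 1 modulo the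
    maximal ideal. That fact is Chevalley's extension theorem
    ([exists_dominating_valuation]) for the ring D[1/x] and its ideal
    m + (1/x) D[1/x], which is proper because x is not integral over D.

    Given the divisibility property, let xy lie in a prime P with x outside D.
    If 1/x is in D, then y = (1/x)(xy) is in P. Otherwise d = xy/x = y is in
    m, and so d^2 = (d/x)(xy) is in P, whence y = d is in P. *)

(** * Premaximal elements above a given one *)

(** Zorn's lemma relative to a starting point: only nonempty chains need an
    upper bound, since the starting point bounds the empty one. *)
Lemma exists_premaximal_above (T : Type) (R : T -> T -> Prop) (t0 : T) :
    (forall t, R t t) -> (forall r s t, R r s -> R s t -> R r t) ->
    (forall A, A !=set0 -> total_on A R -> exists t, forall s, A s -> R s t) ->
  exists2 t, R t0 t & premaximal R t.
Proof.
move=> Rxx Rtr Rub; pose T' := {s | R t0 s}.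
pose R' (a b : T') := `[< R (sval a) (sval b) >].
have [|||t tmax] := @ZL_preorder T' (exist _ t0 (Rxx t0)) R'.
- by move=> a; exact/asboolP.
- by move=> a b c /asboolP ab /asboolP bc; exact/asboolP/(Rtr _ _ _ ab bc).
- move=> A Atot; have [A0|/eqP/set0P A0] := pselect (A = set0).
    by exists (exist _ t0 (Rxx t0)) => s; rewrite A0.
  have [||u uub] := Rub (sval @` A).
  - by case: A0 => b Ab; exists (sval b), b.
  - move=> _ _ [b Ab <-] [c Ac <-].
    by have [/asboolP|/asboolP] := Atot _ _ Ab Ac; [left|right].
  have [b Ab] := A0.
  have t0u : R t0 u by apply: Rtr (svalP b) (uub _ _); exists b.
  by exists (exist _ u t0u) => c Ac; apply/asboolP/uub; exists c.
exists (sval t); first exact: svalP.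
move=> s ts; have t0s : R t0 s := Rtr _ _ _ (svalP t) ts.
by have /asboolP := tmax (exist _ s t0s) (asboolT ts).
Qed.

(** * Chevalley's extension theorem *)

(** A subring of F with a proper ideal of it. Valuation rings arise from the
    pairs that are premaximal for the inclusion of both components. *)
Record proper_pair (F : fieldType) := ProperPair {
  pair_ring : set F;
  pair_ideal : set F;
  pair_ring1 : pair_ring 1;
  pair_ringB : forall a b, pair_ring a -> pair_ring b -> pair_ring (a - b);
  pair_ringM : forall a b, pair_ring a -> pair_ring b -> pair_ring (a * b);
  pair_ideal_sub : pair_ideal `<=` pair_ring;
  pair_ideal0 : pair_ideal 0;
  pair_idealD : forall a b, pair_ideal a -> pair_ideal b -> pair_ideal (a + b);
  pair_idealM : forall a b, pair_ring a -> pair_ideal b -> pair_ideal (a * b);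
  pair_ideal1 : ~ pair_ideal 1 }.

Section ProperPairTheory.
Variable F : fieldType.
Implicit Types (p q : proper_pair F) (x : F).

Definition pair_le p q :=
  pair_ring p `<=` pair_ring q /\ pair_ideal p `<=` pair_ideal q.

Lemma pair_le_refl p : pair_le p p.
Proof. by split. Qed.
Hint Resolve pair_le_refl : core.

Lemma pair_ring0 p : pair_ring p 0.
Proof. exact/pair_ideal_sub/pair_ideal0. Qed.

Lemma pair_ringN p a : pair_ring p a -> pair_ring p (- a).
Proof. by move=> pa; rewrite -sub0r; exact: pair_ringB (pair_ring0 p) pa. Qed.

Lemma pair_ringD p a b :
  pair_ring p a -> pair_ring p b -> pair_ring p (a + b).
Proof.
by move=> pa pb; rewrite -[b]opprK; apply: pair_ringB pa _; exact: pair_ringN.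
Qed.

Lemma pair_chain_ub (C : set (proper_pair F)) : C !=set0 ->
  total_on C pair_le -> exists p, forall q, C q -> pair_le q p.
Proof.
move=> [p0 Cp0] Ctot.
have dir p q : C p -> C q -> exists r, [/\ C r, pair_le p r & pair_le q r].
  move=> Cp Cq; have [pq|qp] := Ctot _ _ Cp Cq; first by exists q.
  by exists p.
pose A := \bigcup_(p in C) pair_ring p; pose I := \bigcup_(p in C) pair_ideal p.
have A1 : A 1 by exists p0 => //; exact: pair_ring1.
have AB a b : A a -> A b -> A (a - b).
  move=> [p Cp pa] [q Cq qb]; have [r [Cr [pr _] [qr _]]] := dir _ _ Cp Cq.
  by exists r => //; apply: pair_ringB; [exact: pr|exact: qr].
have AM a b : A a -> A b -> A (a * b).
  move=> [p Cp pa] [q Cq qb]; have [r [Cr [pr _] [qr _]]] := dir _ _ Cp Cq.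
  by exists r => //; apply: pair_ringM; [exact: pr|exact: qr].
have IA : I `<=` A by move=> a [p Cp pa]; exists p => //; exact: pair_ideal_sub.
have I0 : I 0 by exists p0 => //; exact: pair_ideal0.
have ID a b : I a -> I b -> I (a + b).
  move=> [p Cp pa] [q Cq qb]; have [r [Cr [_ pr] [_ qr]]] := dir _ _ Cp Cq.
  by exists r => //; apply: pair_idealD; [exact: pr|exact: qr].
have IM a b : A a -> I b -> I (a * b).
  move=> [p Cp pa] [q Cq qb]; have [r [Cr [pr _] [_ qr]]] := dir _ _ Cp Cq.
  by exists r => //; apply: pair_idealM; [exact: pr|exact: qr].
have I1 : ~ I 1 by move=> [p _ /pair_ideal1].
exists (ProperPair A1 AB AM IA I0 ID IM I1) => q Cq.
by split=> a qa; exists q.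
Qed.

(** When J is an ideal of a ring A and I an ideal contained in J, this is the
    ideal I + x J[x] of A[x]. The constant coefficients are singled out so as
    to cover two cases: J = I, where it is the extension I A[x], and J = A,
    where it is the ideal generated by I and x, namely I + x A[x]. *)
Definition poly_values (I J : set F) x : set F :=
  [set z | exists f : {poly F},
    [/\ I f`_0, forall i, J f`_i & z = f.[x]]].

Lemma pair_adjoin p (J : set F) x :
    pair_ideal p `<=` J -> J `<=` pair_ring p ->
    (forall a b, J a -> J b -> J (a + b)) ->
    (forall a b, pair_ring p a -> J b -> J (a * b)) ->
    ~ poly_values (pair_ideal p) J x 1 ->
  exists q, [/\ pair_le p q, pair_ring q x &
    poly_values (pair_ideal p) J x `<=` pair_ideal q].
Proof.
move=> IJ JR JD JM I1; set I := poly_values _ _ _ in I1 *.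
have J0 : J 0 by exact/IJ/pair_ideal0.
have R0 := pair_ring0 p.
pose A := poly_values (pair_ring p) (pair_ring p) x.
have A1 : A 1.
  exists 1; rewrite hornerC; split => // [|i]; rewrite coef1 ?eqxx;
    first exact: pair_ring1.
  by case: eqP => _; [exact: pair_ring1|].
have AB a b : A a -> A b -> A (a - b).
  move=> [f [f0 fi ->]] [g [g0 gi ->]]; exists (f - g).
  rewrite hornerD hornerN coefB; split=> // [|i]; rewrite ?coefB;
    exact: pair_ringB.
have AM a b : A a -> A b -> A (a * b).
  move=> [f [f0 fi ->]] [g [g0 gi ->]]; exists (f * g).
  have fg i : pair_ring p (f * g)`_i.
    rewrite coefM; apply: (big_ind (pair_ring p)) => // [*|j _].
      exact: pair_ringD.
    exact: pair_ringM.
  by rewrite hornerM; split.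
have IA : I `<=` A.
  move=> a [f [f0 fi ->]]; exists f; split=> // [|i]; last exact: JR.
  exact: pair_ideal_sub.
have I0 : I 0.
  exists 0; rewrite horner0; split=> // [|i]; rewrite coef0 //.
  exact: pair_ideal0.
have ID a b : I a -> I b -> I (a + b).
  move=> [f [f0 fi ->]] [g [g0 gi ->]]; exists (f + g).
  rewrite hornerD coefD; split=> // [|i]; rewrite ?coefD; last exact: JD.
  exact: pair_idealD.
have IM a b : A a -> I b -> I (a * b).
  move=> [f [f0 fi ->]] [g [g0 gi ->]]; exists (f * g).
  rewrite hornerM coef0M; split=> // [|i]; first exact: pair_idealM.
  rewrite coefM; apply: (big_ind J) => // j _; exact: JM.
exists (ProperPair A1 AB AM IA I0 ID IM I1); split=> //=.
- split=> a pa; exists a%:P; rewrite hornerC coefC eqxx; split=> // i;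
    rewrite coefC; case: eqP => // _; exact: IJ.
- exists 'X; rewrite hornerX coefX; split=> // i; rewrite coefX.
  by case: eqP => _ //; exact: pair_ring1.
Qed.

(** If 1 is a polynomial in x and also a polynomial in 1/x, both with
    coefficients in the ideal I of a pair, then the longer of the two relations
    can be shortened, so no such relations exist. Say 1 = f(x) and
    1 = g(1/x) with f and g of degree at most N > 0, and let a be the
    coefficient of X^N in f and b the constant coefficient of g. The polynomial
    h = X^N g(1/X) has b as coefficient of X^N, and h(x) = x^N, so
    b + (1 - b) f + a (h - X^N) still takes the value 1 at x, has coefficients
    in I, and its terms of degree N cancel. *)
Lemma no_inverse_relations p x n m : x != 0 ->
    (exists f : {poly F},
      [/\ forall i, pair_ideal p f`_i, (size f <= n)%N & f.[x] = 1]) ->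
    (exists g : {poly F},
      [/\ forall i, pair_ideal p g`_i, (size g <= m)%N & g.[x^-1] = 1]) ->
  False.
Proof.
have [N leN] := ubnP (n + m); elim: N x n m leN => // N IH x n m leN.
move=> x0.
wlog : x n m x0 leN / (m <= n)%N.
  move=> W Hf Hg; have [mn|/ltnW nm] := leqP m n; first exact: (W x n m).
  apply: (W x^-1 m n) => //; first by rewrite invr_eq0.
    by rewrite addnC.
  by rewrite invrK.
move=> mn [f [fI fn f1]] Hg; have [g [gI gm g1]] := Hg.
case: n => [|n] in leN mn fn *.
  move: fn f1; rewrite leqn0 size_poly_eq0 => /eqP ->; rewrite horner0 => /eqP.
  by rewrite eq_sym oner_eq0.
case: n => [|n] in leN mn fn *.
  rewrite (size1_polyC fn) hornerC in f1; apply: (@pair_ideal1 _ p).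
  by rewrite -f1.
pose a := f`_n.+1; pose b := g`_0.
pose h := \poly_(i < n.+2) g`_(n.+1 - i).
have hx : h.[x] = x ^+ n.+1.
  rewrite horner_poly (reindex_inj rev_ord_inj) /= -[RHS]mulr1 -g1.
  rewrite (horner_coef_wide _ (leq_trans gm mn)) mulr_sumr.
  apply: eq_bigr => i _; rewrite subSS subKn -1?ltnS //.
  rewrite expfB_cond ?(negPf x0) ?add0n -1?ltnS //.
  by rewrite exprVn; ring.
apply: (IH x n.+1 m _ x0 _ Hg); first by rewrite -ltnS -addSn.
exists (b%:P + (1 - b) *: f + a *: (h - 'X^(n.+1))); split=> [i||].
- rewrite !(coefD, coefZ, coefN) coefC coefXn coef_poly.
  have Ib : pair_ideal p b by exact: gI.
  have R1b : pair_ring p (1 - b).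
    by apply: pair_ringB; [exact: pair_ring1|exact: pair_ideal_sub].
  apply: pair_idealD; first apply: pair_idealD.
  + by case: ifP => // _; exact: pair_ideal0.
  + exact: pair_idealM.
  + rewrite mulrC; apply: pair_idealM; last exact: fI.
    apply: pair_ringB.
      by case: ifP => // _; [exact: pair_ideal_sub|exact: pair_ring0].
    by case: eqP => // _; [exact: pair_ring1|exact: pair_ring0].
- apply/leq_sizeP => j nj.
  rewrite !(coefD, coefZ, coefN) coefC coefXn coef_poly.
  have -> : (j == 0)%N = false by rewrite eqn0Ngt (leq_trans _ nj).
  have [->|jn] := eqVneq j n.+1; first by rewrite ltnSn subnn /= -/a -/b; ring.
  have nj' : (n.+2 <= j)%N by rewrite ltn_neqAle eq_sym jn.
  by rewrite ltnNge nj' /= (nth_default _ (leq_trans fn nj')); ring.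
- by rewrite !hornerE /= f1 hx; ring.
Qed.

Lemma premaximal_pair_valuation p x : premaximal pair_le p -> x != 0 ->
  pair_ring p x \/ pair_ring p x^-1.
Proof.
move=> pmax x0; pose rel y := poly_values (pair_ideal p) (pair_ideal p) y 1.
have grow y : ~ rel y -> pair_ring p y.
  move=> nrel; have [|||||q [pq qy _]] := @pair_adjoin p (pair_ideal p) y.
  - by [].
  - exact: pair_ideal_sub.
  - exact: pair_idealD.
  - exact: pair_idealM.
  - exact: nrel.
  by have [+ _] := pmax _ pq; apply.
have [[f [_ fI f1]]|/grow] := pselect (rel x); last by left.
have [[g [_ gI g1]]|/grow] := pselect (rel x^-1); last by right.
case: (@no_inverse_relations p x (size f) (size g) x0).
  by exists f; split.
by exists g; split.
Qed.

(** Chevalley's theorem: the ideal of the pair ends up among the nonunits of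
    the valuation ring. *)
Lemma exists_dominating_valuation p : exists V : set F,
  [/\ subring_closed [in V], pair_ring p `<=` V,
      forall x, x != 0 -> V x \/ V x^-1 &
      forall x, pair_ideal p x -> ~ V x^-1 \/ x = 0].
Proof.
have [|||q [pqR pqI] qmax] := @exists_premaximal_above _ pair_le p.
- by move=> ?; split.
- by move=> r s t [rs rs'] [st st']; split; apply: subset_trans; eassumption.
- exact: pair_chain_ub.
exists (pair_ring q); split=> //.
- split; first exact/mem_set/pair_ring1.
    by move=> a b /set_mem qa /set_mem qb; exact/mem_set/pair_ringB.
  by move=> a b /set_mem qa /set_mem qb; exact/mem_set/pair_ringM.
- by move=> x; exact: premaximal_pair_valuation.
- move=> x /pqI qx; have [->|x0] := eqVneq x 0; [by right|left=> qx'].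
  by apply: (@pair_ideal1 _ q); rewrite -(mulVf x0); exact: pair_idealM.
Qed.

End ProperPairTheory.

(** * Valuation overrings *)

Section ZarTheory.
Variables (D : idomainType) (V : Zar D).
Implicit Types a b z : {fraction D}.

Lemma zar_ring1 : zar_ring V 1.
Proof. by have [/set_mem] := zar_subring V. Qed.

Lemma zar_ringB a b : zar_ring V a -> zar_ring V b -> zar_ring V (a - b).
Proof.
move=> Va Vb; have [_ VB _] := zar_subring V.
exact/set_mem/VB/mem_set/Vb/mem_set.
Qed.

Lemma zar_ringD a b : zar_ring V a -> zar_ring V b -> zar_ring V (a + b).
Proof.
have V0 : zar_ring V 0.
  by rewrite -(subrr 1); apply: zar_ringB; exact: zar_ring1.
by move=> Va Vb; rewrite -[b]opprK -[- b]sub0r; do 2!apply: zar_ringB => //.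
Qed.

Lemma zar_ringM a b : zar_ring V a -> zar_ring V b -> zar_ring V (a * b).
Proof.
move=> Va Vb; have [_ _ VM] := zar_subring V.
exact/set_mem/VM/mem_set/Vb/mem_set.
Qed.

Lemma zar_ringX a n : zar_ring V a -> zar_ring V (a ^+ n).
Proof.
move=> Va; elim: n => [|n IH]; first by rewrite expr0; exact: zar_ring1.
by rewrite exprS; exact: zar_ringM.
Qed.

(** Valuation rings are closed under roots: z = z^(n+1) (1/z)^n. *)
Lemma zar_ring_root z n : zar_ring V (z ^+ n.+1) -> zar_ring V z.
Proof.
move=> Vzn; have [->|z0] := eqVneq z 0.
  by rewrite -(subrr 1); apply: zar_ringB; exact: zar_ring1.
have [//|Vz'] := zar_valuation V z0.
have -> : z = z ^+ n.+1 * z^-1 ^+ n.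
  by rewrite exprS exprVn mulfK // expf_neq0.
by apply: zar_ringM => //; exact: zar_ringX.
Qed.

Lemma open_zar_ring x : open [set W : Zar D | zar_ring W x].
Proof.
exists [set [set W : Zar D | zar_ring W x]]; last by rewrite bigcup_set1.
move=> _ ->; apply: (@finI_from1 _ _ _ id).
exists [:: x] => //; apply/seteqP; split=> W /=.
  by apply; rewrite mem_head.
by move=> Wx z; rewrite inE => /eqP ->.
Qed.

End ZarTheory.

(** The valuation overrings are closed under intersections of chains: if x is
    missing from a member U, then 1/x belongs to U and to all larger members,
    and the smaller members also miss x. *)
Lemma exists_Zar_min_below (D : idomainType) (V : Zar D) :
  exists2 W : Zar D, Zar_min W & W `<=` V.
Proof.
have [|||W WV Wmax] := @exists_premaximal_above (Zar D) (fun V W => W `<=` V) V.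
- by move=> ?; exact: subset_refl.
- by move=> ? ? ? VU WV; exact: subset_trans WV VU.
- move=> C [V0 CV0] Ctot; pose B := \bigcap_(U in C) zar_ring U.
  have Bsub : subring_closed [in B].
    split.
    + by apply/mem_set => U CU; have [/set_mem] := zar_subring U.
    + move=> a b /set_mem aB /set_mem bB; apply/mem_set => U CU.
      have [_ Ub _] := zar_subring U.
      by apply/set_mem/Ub; apply/mem_set; [exact: aB|exact: bB].
    + move=> a b /set_mem aB /set_mem bB; apply/mem_set => U CU.
      have [_ _ Um] := zar_subring U.
      by apply/set_mem/Um; apply/mem_set; [exact: aB|exact: bB].
  have BD : range (@tofrac D) `<=` B.
    by move=> a Da U CU; exact: zar_overring.
  have Bval x : x != 0 -> B x \/ B x^-1.
    move=> x0; have [|/existsNP[U /not_implyP[CU nUx]]] := pselect (B x).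
      by left.
    right=> U' CU'; have [U'U|UU'] := Ctot _ _ CU CU'.
      by have [/U'U|] := zar_valuation U' x0.
    by apply: UU'; have [] := zar_valuation U x0.
  by exists (MkZar Bsub BD Bval) => U CU x; apply.
exists W => // U UW; exact: Wmax.
Qed.

(** * Local domains *)

Lemma proper_ideal_sub_maximal (D : idomainType) (I : set D) :
  idealr_closed [in I] -> exists2 M, maximal_ideal M & I `<=` M.
Proof.
move=> Iid; pose T := {J : set D | idealr_closed [in J]}.
pose R (J J' : T) := sval J `<=` sval J'.
have [|||[M Mid] /= IM Mmax] := @exists_premaximal_above T R (exist _ I Iid).
- by move=> J; exact: subset_refl.
- by move=> J K L JK KL; exact: subset_trans JK KL.
- move=> C [J0 CJ0] Ctot.
  have Uid : idealr_closed [in \bigcup_(J in C) sval J].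
    split.
    + apply/mem_set; exists J0 => //; apply/set_mem.
      by have [] := svalP J0.
    + apply/negP => /set_mem [J _ J1]; have [_ /negP J1' _] := svalP J.
      exact/J1'/mem_set.
    + move=> a u v /set_mem [J CJ Ju] /set_mem [K CK Kv]; apply/mem_set.
      have [JK|KJ] := Ctot _ _ CJ CK.
        exists K => //; have [_ _ Kl] := svalP K.
        by apply/set_mem/Kl; apply/mem_set => //; exact: JK.
      exists J => //; have [_ _ Jl] := svalP J.
      by apply/set_mem/Jl; apply/mem_set => //; exact: KJ.
  exists (@exist _ (fun J : set D => idealr_closed [in J]) _ Uid).
  by move=> J CJ x Jx; exists J.
exists M => //; split=> // J Jid MJ; apply/seteqP; split=> //.
exact: (Mmax (@exist _ (fun J : set D => idealr_closed [in J]) J Jid)).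
Qed.

Lemma local_nonunit_ideal (D : idomainType) : local_domain D ->
  exists2 M : set D, idealr_closed [in M] &
    forall a, M a <-> a \isn't a GRing.unit.
Proof.
move=> [M [[Mid Mmax] Muniq]]; exists M => // a; split.
  move=> Ma; apply/negP => ua; have [M0 /negP M1 Ml] := Mid; apply: M1.
  rewrite -(mulVr ua) -[_ * _]addr0; exact: Ml (mem_set Ma) M0.
move=> ua; pose I : set D := [set x | exists b, x = b * a].
have [|N Nmax IN] := @proper_ideal_sub_maximal D I.
  split.
  - by apply/mem_set; exists 0; rewrite mul0r.
  - apply/negP => /set_mem [b b1]; move/negP: ua; apply.
    by apply/unitrP; exists b; rewrite [a * b]mulrC -b1.
  - move=> c u v /set_mem [b ->] /set_mem [d ->]; apply/mem_set.
    by exists (c * b + d); ring.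
by rewrite (Muniq _ Nmax); apply: IN; exists 1; rewrite mul1r.
Qed.

(** * Identities in a field *)

Lemma invfVD1 (F : fieldType) (a : F) :
  a != 0 -> 1 + a != 0 -> (a^-1 + 1)^-1 = a / (1 + a).
Proof. by move=> a0 a1; field; rewrite a0 a1. Qed.

Lemma invf_sub1_div (F : fieldType) (w : F) :
  w != 0 -> w^-1 = 1 - (w - 1) / w.
Proof. by move=> w0; field. Qed.

Lemma invf_sub1 (F : fieldType) (w : F) :
  w != 0 -> w - 1 != 0 -> (w - 1)^-1 = ((w - 1) / w)^-1 - 1.
Proof. by move=> w0 w1; field; rewrite w0 w1. Qed.

(** * Valuation overrings of an integrally closed local domain *)

Section LocalIntegrallyClosed.
Variable D : idomainType.
Variable M : set D.
Hypothesis D_closed : integrally_closed D.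
Hypothesis M_ideal : idealr_closed [in M].
Hypothesis M_nonunit : forall a, M a <-> a \isn't a GRing.unit.

Let K := {fraction D}.
Let f : D -> K := @tofrac D.
Let A : set K := range f.

Lemma ideal_combine a u v : M u -> M v -> M (a * u + v).
Proof.
by move=> Mu Mv; have [_ _ Ml] := M_ideal; exact/set_mem/Ml/mem_set/Mv/mem_set.
Qed.

Let M0 : M 0. Proof. by have [/set_mem] := M_ideal. Qed.

Lemma frac_pair : exists p : proper_pair K,
  pair_ring p = A /\ pair_ideal p = f @` M.
Proof.
unshelve eexists (@ProperPair K A (f @` M) _ _ _ _ _ _ _ _); last by split.
- by exists 1 => //; rewrite /f tofrac1.
- by move=> _ _ [a _ <-] [b _ <-]; exists (a - b) => //; rewrite /f tofracB.
- by move=> _ _ [a _ <-] [b _ <-]; exists (a * b) => //; rewrite /f tofracM.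
- by move=> _ [a _ <-]; exists a.
- by exists 0; rewrite /f ?tofrac0.
- move=> _ _ [a Ma <-] [b Mb <-]; exists (a + b); last by rewrite /f tofracD.
  by rewrite -[a]mul1r; exact: ideal_combine.
- move=> _ _ [a _ <-] [b Mb <-]; exists (a * b); last by rewrite /f tofracM.
  by rewrite -[_ * _]addr0; exact: ideal_combine.
- move=> [a Ma] /(congr1 (fun x => x - 1)); rewrite subrr /f -tofrac1 -tofracB.
  move/eqP; rewrite tofrac_eq0 subr_eq0 => /eqP a1.
  by move/M_nonunit: Ma; rewrite a1 unitr1.
Qed.

(** A relation 1 = c_0 + c_1/x + ... + c_N/x^N with c_0 in m, multiplied by
    x^N, reads (1 - c_0) x^N = c_1 x^(N-1) + ... + c_N; as 1 - c_0 is a unit,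
    it makes x integral over D. *)
Lemma no_relation_inverse x : ~ A x -> ~ poly_values (f @` M) A x^-1 1.
Proof.
move=> nAx [g [[m Mm fm] gA g1]]; apply: nAx.
have x0 : x != 0.
  apply: contraPneq g1 => ->; rewrite invr0 horner_coef0 -fm => /esym/eqP.
  rewrite /f -tofrac1 tofrac_eq => /eqP m1.
  by move/M_nonunit: Mm; rewrite m1 unitr1.
have gA' i : exists a, f a = g`_i by have [a _] := gA i; exists a.
have [c cP] := choice gA'.
have c0 : c 0 = m.
  by have /eqP := cP 0%N; rewrite -fm /f tofrac_eq => /eqP.
pose e := 1 - c 0.
have eu : e \is a GRing.unit.
  apply: contrapT => /negP /M_nonunit Me; have : M 1.
    rewrite -(subrK (c 0) 1) -[_ - _]mul1r.
    by apply: ideal_combine; [exact: Me|rewrite c0].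
  by move/M_nonunit; rewrite unitr1.
have [N gN] : exists N, (size g <= N.+1)%N by exists (size g).
pose q := \poly_(j < N) c (N - j)%N.
have qx : f e * x ^+ N = (map_poly f q).[x].
  have -> : f e * x ^+ N = x ^+ N - f (c 0) * x ^+ N.
    by rewrite /f tofracB tofrac1 mulrBl mul1r.
  have {1}-> : x ^+ N = g.[x^-1] * x ^+ N by rewrite -g1 mul1r.
  rewrite (horner_coef_wide _ gN) mulr_suml big_ord_recl /= expr0 mulr1.
  rewrite cP addrC addKr.
  rewrite (@horner_coef_wide _ N); last first.
    exact: leq_trans (size_poly _ _) (size_poly _ _).
  rewrite [RHS](reindex_inj rev_ord_inj) /=; apply: eq_bigr => i _.
  rewrite coef_map coef_poly /= ltn_subrL (leq_trans _ (ltn_ord i)) //=.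
  rewrite subKn // -[tofrac _]/(f _) cP /bump add1n -mulrA; congr (_ * _).
  by rewrite expfB_cond ?(negPf x0) ?add0n // exprVn mulrC.
apply: D_closed; exists ('X^N - e^-1 *: q).
  apply/monicP; rewrite lead_coefDl ?lead_coefXn // size_polyXn size_polyN ltnS.
  exact: leq_trans (size_scale_leq _ _) (size_poly _ _).
rewrite /root rmorphB /= map_polyXn map_polyZ !hornerE -qx mulrA.
by rewrite -rmorphM mulVr // rmorph1 mul1r subrr.
Qed.

Lemma exists_dominating_avoiding x : ~ A x -> exists V : Zar D,
  ~ zar_ring V x /\ forall m, M m -> m != 0 -> ~ zar_ring V (f m)^-1.
Proof.
move=> nAx; have x0 : x != 0.
  by apply: contra_notN nAx => /eqP ->; exists 0; rewrite /f ?tofrac0.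
have [p [pR pI]] := frac_pair.
have [|||||q [[pqR pqI] _ qI]] := @pair_adjoin _ p A x^-1.
- by rewrite -pR; exact: pair_ideal_sub.
- by rewrite pR.
- by rewrite -pR; exact: pair_ringD.
- by rewrite -pR; exact: pair_ringM.
- by rewrite pI; exact: no_relation_inverse.
have [V [Vsub qV Vval Vdom]] := exists_dominating_valuation q.
have AV : range f `<=` V by rewrite -/A -pR; exact: subset_trans qV.
exists (MkZar Vsub AV Vval); split=> /= [Vx|m Mm m0].
  have [||] := Vdom x^-1; last by move/eqP; rewrite invr_eq0 (negPf x0).
    apply: qI; exists 'X; rewrite hornerX coefX /=; split=> //.
      exact: pair_ideal0.
    move=> i; rewrite coefX -pR; case: eqP => _; first exact: pair_ring1.
    exact: pair_ring0.
  by rewrite invrK.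
have [||/eqP] := Vdom (f m); last by rewrite tofrac_eq0 (negPf m0).
  by apply: pqI; rewrite pI; exists m.
by [].
Qed.

Lemma exists_min_avoiding x : ~ A x -> exists V : Zar D,
  [/\ Zar_min V, ~ zar_ring V x &
      forall m, M m -> m != 0 -> ~ zar_ring V (f m)^-1].
Proof.
move=> /exists_dominating_avoiding[V [Vx Vdom]].
have [W Wmin WV] := exists_Zar_min_below V.
exists W; split=> // [/WV//|m Mm m0 /WV]; exact: Vdom.
Qed.

(** Neither w nor 1/w is in D, so 1/(w - 1) is not in D: if it were some a in
    D, then w = (1 + a)/a and 1/w = a/(1 + a), while a or 1 + a is a unit of
    D. In a valuation ring missing 1/(w - 1), the element w is congruent to 1
    modulo the maximal ideal. *)
Lemma exists_min_unit w : ~ A w -> ~ A w^-1 -> exists V : Zar D,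
  [/\ Zar_min V, zar_ring V w, zar_ring V w^-1 &
      forall m, M m -> m != 0 -> ~ zar_ring V (f m)^-1].
Proof.
move=> nAw nAw'.
have w0 : w != 0.
  by apply: contra_notN nAw => /eqP ->; exists 0; rewrite /f ?tofrac0.
have w1 : w - 1 != 0.
  rewrite subr_eq0; apply: contra_notN nAw => /eqP ->.
  by exists 1; rewrite /f ?tofrac1.
have nAz : ~ A (w - 1)^-1.
  move=> [a _ fa]; have wE : w = (f a)^-1 + 1 by rewrite fa invrK subrK.
  have [ua|/M_nonunit Ma] := boolP (a \is a GRing.unit).
    apply: nAw; exists (a^-1 + 1) => //.
    by rewrite wE /f tofracD tofrac1 rmorphV.
  have u1a : 1 + a \is a GRing.unit.
    apply: contrapT => /negP /M_nonunit M1a; have : M 1.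
      by rewrite -(addrK a 1) addrC -mulN1r; exact: ideal_combine.
    by move/M_nonunit; rewrite unitr1.
  have fa0 : f a != 0 by rewrite fa invr_eq0.
  have f1a0 : 1 + f a != 0.
    rewrite /f -tofrac1 -tofracD tofrac_eq0; apply: contraTneq u1a => ->.
    by rewrite unitr0.
  apply: nAw'; exists (a / (1 + a)) => //.
  rewrite /f rmorphM rmorphV //= tofracD tofrac1 -/f wE.
  by rewrite invfVD1.
have [V [Vmin Vz Vdom]] := exists_min_avoiding nAz.
exists V; split=> //.
  have [Vw1|//] := zar_valuation V w1.
  by rewrite -(subrK 1 w); apply: zar_ringD => //; exact: zar_ring1.
have u0 : (w - 1) / w != 0 by rewrite mulf_neq0 ?invr_eq0.
have [Vu|Vu] := zar_valuation V u0.
  by rewrite (invf_sub1_div w0); apply: zar_ringB => //; exact: zar_ring1.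
by case: Vz; rewrite (invf_sub1 w0 w1); apply: zar_ringB => //; exact: zar_ring1.
Qed.

(** * The Noetherian condition *)

Lemma frac_root z n : A (z ^+ n.+1) -> A z.
Proof.
move=> [a _ az]; apply: D_closed; exists ('X^(n.+1) - a%:P).
  exact: monicXnsubC.
by rewrite /root rmorphB /= map_polyXn map_polyC !hornerE -az subrr.
Qed.

(** Otherwise the sets of all minimal V containing e_n = t^n / y^(n+1), that
    is, v(y) <= n/(n+1) v(t), form an infinite strictly ascending sequence of
    open sets. *)
Lemma noetherian_div y t : noetherian_space (set_type (@Zar_min D)) ->
  M t -> ~ A y -> A (f t / y).
Proof.
move=> noeth Mt nAy; apply: contrapT => nAty.
have y0 : y != 0.
  by apply: contra_notN nAy => /eqP ->; exists 0; rewrite /f ?tofrac0.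
have t0 : t != 0.
  by apply: contra_notN nAty => /eqP ->; exists 0; rewrite /f ?tofrac0 ?mul0r.
have ft0 : f t != 0 by rewrite tofrac_eq0.
pose e n := f t ^+ n / y ^+ n.+1.
have e0 n : e n != 0 by rewrite mulf_neq0 ?invr_eq0 ?expf_neq0.
(* The identity behind the monotonicity of U and its strictness: it compares
   e_n and e_(n+1) up to one factor t. *)
have eS n : e n.+1 ^+ n.+1 = e n ^+ n.+2 * f t.
  rewrite !expr_div_n -!exprM mulrAC -exprSr; congr (_ ^+ _ / _ ^+ _).
    by rewrite mulSn !mulnS addSn.
  exact: mulnC.
have nAe n : ~ A (e n).
  move=> [a _ ea]; apply: nAty; apply: (@frac_root _ n).
  exists (a * t) => //; rewrite [LHS]tofracM -!/(f _) ea /e expr_div_n.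
  by rewrite (exprSr (f t)) mulrAC.
have nAe' n : ~ A (e n)^-1.
  move=> [a _ ea]; apply: nAy; apply: (@frac_root _ n).
  exists (a * t ^+ n) => //; rewrite [LHS]tofracM tofracXn -!/(f _) ea /e.
  by rewrite invf_div divfK // expf_neq0.
pose U n := [set V : set_type (@Zar_min D) | zar_ring (set_val V) (e n)].
have [|n|N UN] := noeth U.
- move=> n; exists [set W : Zar D | zar_ring W (e n)] => //.
  exact: open_zar_ring.
- move=> V Ve; apply: (@zar_ring_root _ _ _ n); rewrite eS; apply: zar_ringM.
    exact: zar_ringX.
  by apply: zar_overring; exists t.
(* Where e_(N+1) is a unit, the slope v(y)/v(t) is exactly (N+1)/(N+2), so
   this ring belongs to U_(N+1) but not to U_N. *)
have [V [Vmin Ve Ve' Vdom]] := exists_min_unit (@nAe N.+1) (@nAe' N.+1).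
have : U N.+1 (SigSub (mem_set Vmin)) by [].
rewrite UN // => /= VeN; apply: (Vdom t) => //.
have -> : (f t)^-1 = e N ^+ N.+2 * (e N.+1)^-1 ^+ N.+1.
  by rewrite exprVn eS invfM mulVKf // expf_neq0.
by apply: zar_ringM; exact: zar_ringX.
Qed.

Lemma noetherian_div_ideal y t : noetherian_space (set_type (@Zar_min D)) ->
  M t -> ~ A y -> ~ A y^-1 -> (f @` M) (f t / y).
Proof.
move=> noeth Mt nAy nAy'; have [a _ fa] := noetherian_div noeth Mt nAy.
exists a => //; apply/M_nonunit/negP => ua; apply: nAy; exists (t / a) => //.
have y0 : y != 0.
  by apply: contra_notN nAy' => /eqP ->; exists 0; rewrite /f ?tofrac0 ?invr0.
have ft0 : f t != 0.
  rewrite -[f t](divfK y0) -fa mulf_neq0 // tofrac_eq0.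
  by apply: contraTneq ua => ->; rewrite unitr0.
rewrite /f rmorphM rmorphV //= -!/(f _) fa.
by rewrite invf_div mulrC divfK.
Qed.

(** If 1/x is not in D either, two divisions by x of elements of m show that
    y = xy/x is in m and that (xy/x)/x is in D; then y^2 = ((xy/x)/x)(xy) is in
    P. *)
Lemma noetherian_prime (P : set D) x y :
    noetherian_space (set_type (@Zar_min D)) -> prime_ideal P ->
  (f @` P) (x * y) -> ~ A x -> (f @` P) y.
Proof.
move=> noeth Pprime; have [[_ /negP P1 Pl] Pp] := Pprime; move=> [p Pp' fp] nAx.
have P0 : P 0 by have [[/set_mem]] := Pprime.
have PMl a b : P b -> P (a * b).
  by move=> Pb; rewrite -[_ * _]addr0; exact/set_mem/Pl/mem_set/P0/mem_set.
have PM a : P a -> M a.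
  move=> Pa; apply/M_nonunit/negP => ua; apply: P1; apply/mem_set.
  by rewrite -(mulVr ua); exact: PMl.
have x0 : x != 0.
  by apply: contra_notN nAx => /eqP ->; exists 0; rewrite /f ?tofrac0.
have yE : y = f p / x by rewrite fp mulrC mulKf.
have [[d _ fd]|nAx'] := pselect (A x^-1).
  exists (d * p); first exact: PMl.
  by rewrite [LHS]tofracM -!/(f _) fd yE mulrC.
have [d Md fd] := noetherian_div_ideal noeth (PM _ Pp') nAx nAx'.
have [c _ fc] := noetherian_div noeth Md nAx.
exists d; last by rewrite yE.
have : P (d * d).
  have -> : d * d = c * p; last exact: PMl.
  apply/eqP; rewrite -tofrac_eq !tofracM -!/(f _) fc fd; apply/eqP; ring.
by move/mem_set/Pp/orP => [] /set_mem.
Qed.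

End LocalIntegrallyClosed.

(* [set_type A] carries the subspace topology on the set A. *)
Theorem theorem5p8 (D : idomainType)
    (D_integrally_closed : integrally_closed D) (D_local : local_domain D)
    (Zar_min_noetherian : noetherian_space (set_type (@Zar_min D))) :
  pseudo_valuation_domain D.
Proof.
have [M Mid Mnu] := local_nonunit_ideal D_local.
move=> P Pprime x y Pxy.
have main :=
  noetherian_prime D_integrally_closed Mid Mnu Zar_min_noetherian Pprime.
have [[a _ fa]|nAx] := pselect (range (@tofrac D) x); last first.
  by right; exact: main Pxy nAx.
have [[b _ fb]|nAy] := pselect (range (@tofrac D) y); last first.
  by left; apply: main nAy; rewrite mulrC.
have [p Pp] := Pxy; rewrite -fa -fb -tofracM => /eqP.
rewrite tofrac_eq => /eqP pE.
have [_ /(_ a b)] := Pprime.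
rewrite -pE (mem_set Pp) => /(_ isT) /orP[]/set_mem ?.
  by left; exists a.
by right; exists b.
Qed.
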